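(* Let $F>0$ and let $i\in\mathcal N$ be a channel with rate $r_i>0$ and availability probability $p_i\in(0,1]$. The expected transfer time of a file of size $F$ under the static policy that always uses channel $i$ is $$\mathbb{E}[T(i,F)] = \Delta\left(\frac{k_i}{p_i} + \mathbf 1_{\{\alpha_i>0\}}\,\frac{1-p_i}{p_i} + \alpha_i\right),$$ where $k_i = \lfloor F/(\Delta r_i)\rfloor\in\mathbb Z_+$ and $\alpha_i = F/(\Delta r_i) - k_i\in[0,1)$.
   Context: There is a finite set of channels $\mathcal N=\{1,\dots,N\}$ and a fixed slot length $\Delta>0$. Channel $i$ has rate $r_i>0$ and availability probability $p_i\in(0,1]$. For each $i\in\mathcal N$, $\{Y_i(k)\}_{k=0,1,2,\dots}$ is an i.i.d. Bernoulli sequence with $P[Y_i(k)=1]=p_i=1-P[Y_i(k)=0]$, and these sequences are independent over channels. The state of channel $i$ at real time $t\ge 0$ is $X_i(t)=Y_i(\lfloor t/\Delta\rfloor)$ (1 = available, 0 = unavailable). Data is transferred on channel $i$ at time $t$ at rate $r_iX_i(t)$. The static policy on channel $i$ uses channel $i$ at all times, and its transfer time for a file of size $F$ is the random variable $$T(i,F)=\min\Big\{T\ge 0:\ \int_0^{T} r_iX_i(t)\,dt\ \ge F\Big\}.$$ $\mathbb Z_+$ denotes the nonnegative integers and $\mathbf 1_{\{\cdot\}}$ is the indicator (equal to 1 if the condition holds, 0 otherwise). *)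

(* Defs.v *)
From HB Require Import structures.
From mathcomp Require Import all_boot all_order all_algebra finmap.
From mathcomp Require Import all_classical all_reals all_analysis.
Set Implicit Arguments.
Unset Strict Implicit.
Unset Printing Implicit Defensive.
Import Order.TTheory GRing.Theory Num.Theory.
Import numFieldNormedType.Exports.
Local Open Scope classical_set_scope.
Local Open Scope ring_scope.

(* Mutual independence of a family of classes of events (in use, of
   sigma-algebras): the product rule for every finite subfamily. *)
Definition mutually_independent d (Omega : measurableType d) (R : realType)
    (P : probability Omega R) (I : choiceType)
    (G : I -> set (set Omega)) : Prop :=
  forall (J : {fset I}) (A : I -> set Omega),
    (forall j, j \in J -> G j (A j)) ->
    P (\bigcap_(j in [set` J]) A j) = (\prod_(j <- J) P (A j))%E.

Definition sigma_of_rv d d' (Omega : measurableType d) (T : measurableType d')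
    (X : Omega -> T) : set (set Omega) :=
  preimage_set_system setT X measurable.

Definition sigma_of_sequence d d' (Omega : measurableType d)
    (T : measurableType d') (X : nat -> Omega -> T) : set (set Omega) :=
  <<s \bigcup_k sigma_of_rv (X k) >>.

Definition iid_bernoulli d (Omega : measurableType d) (R : realType)
    (P : probability Omega R) (p : R) (Y : nat -> {RV P >-> bool}) : Prop :=
  (forall k, distribution P (Y k) =1 bernoulli_prob p) /\
  mutually_independent P (fun k => sigma_of_rv (Y k)).

Definition independent_sequences d (Omega : measurableType d) (R : realType)
    (P : probability Omega R) (I : choiceType)
    (Y : I -> nat -> {RV P >-> bool}) : Prop :=
  mutually_independent P (fun i => sigma_of_sequence (Y i)).

(* Num.truncn is the nat-valued floor on nonnegative reals; the value at
   t < 0 is irrelevant. *)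
Definition channel_state (Omega : Type) (R : realType) (Delta : R)
    (Y : nat -> Omega -> bool) (t : R) (w : Omega) : bool :=
  Y (Num.truncn (t / Delta)) w.

Definition data_transferred (Omega : Type) (R : realType) (Delta r : R)
    (Y : nat -> Omega -> bool) (T : R) (w : Omega) : R :=
  \int[lebesgue_measure]_(t in `[0, T]) (r * (channel_state Delta Y t w)%:R).

(* The least element of S, and +oo when S has none. *)
Definition emin (R : realType) (S : set R) : \bar R :=
  xget +oo%E (EFin @` (S `&` lbound S)).

(* Extended-real valued: it is +oo at outcomes for which the file is never
   completely transferred. *)
Definition transfer_time (Omega : Type) (R : realType) (Delta r : R)
    (Y : nat -> Omega -> bool) (F : R) (w : Omega) : \bar R :=
  emin [set T : R | 0 <= T /\ F <= data_transferred Delta r Y T w].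

Arguments iid_bernoulli {d Omega R} P p Y.
Arguments independent_sequences {d Omega R} P {I} Y.

(* Main.v *)
(* In units of the slot length, let c = F / (Delta r) and let S_n be the number
   of available slots among the first n. Slot n contributes to the transfer time
   a full slot if S_(n+1) < c, the fraction c - S_n if S_n < c <= S_(n+1), and
   nothing afterwards; the resulting series equals the transfer time at every
   outcome, including those where it is infinite. Since Y_n is independent of
   S_n, taking expectations leaves the potential sum_n P(S_n = s), which is 1/p
   for every s: the walk stays a geometric time of mean 1/p at each level. *)

Require Import Defs.
From HB Require Import structures.
From mathcomp Require Import all_boot all_order all_algebra finmap.
From mathcomp Require Import all_classical all_reals all_analysis.
From mathcomp Require Import measurable_realfun ring lra.
Set Implicit Arguments.
Unset Strict Implicit.
Unset Printing Implicit Defensive.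
Import Order.TTheory GRing.Theory Num.Theory.
Import numFieldNormedType.Exports.
Local Open Scope classical_set_scope.
Local Open Scope ring_scope.

(** * Slot counts and the path of one channel at a fixed outcome *)

Definition successes (Omega : Type) (Y : nat -> Omega -> bool) (n : nat)
  (w : Omega) : nat := (\sum_(0 <= j < n) Y j w)%N.

Lemma successes0 (Omega : Type) (Y : nat -> Omega -> bool) w :
  successes Y 0 w = 0%N.
Proof. by rewrite /successes big_geq. Qed.

Lemma successesS (Omega : Type) (Y : nat -> Omega -> bool) n w :
  successes Y n.+1 w = (successes Y n w + Y n w)%N.
Proof. by rewrite /successes big_nat_recr. Qed.

Lemma leq_successes (Omega : Type) (Y : nat -> Omega -> bool) w :
  {homo (successes Y)^~ w : m n / (m <= n)%N}.
Proof.
apply: homo_leq => [//|? ? ?|n]; first exact: leq_trans.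
by rewrite successesS leq_addr.
Qed.

Section path_of_one_channel.
Context (Omega : Type) (R : realType) (Delta : R) (Y : nat -> Omega -> bool)
  (w : Omega).
Hypothesis Delta_gt0 : 0 < Delta.

Local Notation S n := (successes Y n w).

Lemma truncn_slotE (n : nat) (t : R) : 0 <= t ->
  (Num.truncn (t / Delta) == n) = (n%:R * Delta <= t < n.+1%:R * Delta).
Proof.
move=> t0; have td0 : 0 <= t / Delta by rewrite divr_ge0// ltW.
by rewrite truncn_eq// ler_pdivlMr// ltr_pdivrMr.
Qed.

Lemma channel_state_slot (n : nat) (t : R) :
  n%:R * Delta <= t < n.+1%:R * Delta -> channel_state Delta Y t w = Y n w.
Proof.
move=> nt; rewrite /channel_state.
suff /eqP-> : Num.truncn (t / Delta) == n by [].
rewrite truncn_slotE//; apply: le_trans (andP nt).1.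
by rewrite mulr_ge0// ltW.
Qed.

Lemma integrable_channel_state (r T : R) :
  lebesgue_measure.-integrable `[0, T]
    (EFin \o (fun t => r * (channel_state Delta Y t w)%:R)).
Proof.
apply: measurable_bounded_integrable => //.
- by rewrite /= lebesgue_measure_itv/=; case: ifPn => _ //; exact: ltry.
- apply: measurable_funM => //.
  have mb : measurable_fun [set: bool] (fun b : bool => b%:R : R) by [].
  apply: (measurableT_comp mb (g := channel_state Delta Y ^~ w)).
  apply: (measurable_fun_bool true).
  (* The times of availability form a countable union of half-open slots, hence a measurable set. *)
  rewrite (_ : _ `&` _ = `[0, T] `&` \bigcup_(n in [set n | Y n w])
      [set` `[n%:R * Delta, n.+1%:R * Delta[]).
    by apply: measurableI => //; exact: bigcup_measurable.
  apply/seteqP; split => t /= [].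
    rewrite in_itv/= => /andP[t0 tT] yt; split; first by rewrite t0.
    exists (Num.truncn (t / Delta)) => //=.
    by rewrite in_itv/= -truncn_slotE.
  move=> tT [n /= yn]; rewrite in_itv/= => /channel_state_slot nt; split => //.
  by rewrite nt.
- exists `|r|; split => // M rM t _ /=; apply: le_trans (ltW rM).
  by rewrite normrM ler_piMr// normr_nat; case: channel_state.
Qed.

(** The state is constant on a slot, so the data grows linearly there. Both endpoints are allowed,
    so that the value at the end of one slot starts the next. *)
Lemma data_transferred_slot (r : R) (n : nat) (T : R) :
  n%:R * Delta <= T <= n.+1%:R * Delta ->
  data_transferred Delta r Y T w =
  r * Delta * (S n)%:R + r * (Y n w)%:R * (T - n%:R * Delta).
Proof.
have extend m U : m%:R * Delta <= U <= m.+1%:R * Delta ->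
    data_transferred Delta r Y U w =
    data_transferred Delta r Y (m%:R * Delta) w +
    r * (Y m w)%:R * (U - m%:R * Delta).
  move=> /andP[mU Um].
  have m0 : 0 <= m%:R * Delta by rewrite mulr_ge0// ltW.
  apply/eqP; rewrite addrC -subr_eq; apply/eqP.
  rewrite /data_transferred Rintegral_itvB ?bnd_simp//; last first.
    exact: integrable_channel_state.
  (* The right endpoint is dropped: [U] may be the end of slot [m], where the state is already that
     of slot [m.+1]. *)
  rewrite -Rintegral_itv_bndo_bndc; last first.
    apply: integrableS (integrable_channel_state r U) => //.
    move=> t /=; rewrite !in_itv/= => /andP[h1 h2].
    by rewrite (le_trans m0 (ltW h1)) ltW.
  rewrite (@eq_Rintegral _ _ _ _ _ (cst (r * (Y m w)%:R))); last first.
    move=> t /[!inE]/=; rewrite in_itv/= => /andP[h1 h2].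
    by rewrite (@channel_state_slot m)// (ltW h1) (lt_le_trans h2).
  rewrite Rintegral_cst//= lebesgue_measure_itv/= lte_fin.
  case: ltP => [|h] //=.
  by rewrite (@le_anti _ _ U (m%:R * Delta)) ?h ?mU// subrr !mulr0.
elim: n T => [|n IH] T hT; rewrite (extend _ _ hT).
  rewrite mul0r successes0 mulr0 add0r /data_transferred.
  by rewrite set_itv1 Rintegral_set1 add0r.
have -> : data_transferred Delta r Y (n.+1%:R * Delta) w =
    r * Delta * (S n.+1)%:R.
  rewrite IH; last by rewrite lexx andbT ler_pM2r// ler_nat.
  by rewrite successesS natrD -natr1; ring.
by [].
Qed.

(* The transmission time falling in one slot, in slot lengths, when [c] slots
   of availability are needed and the slot raises the count from [s] to [s']. *)
Definition slot_time (c : R) (s s' : nat) : R :=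
  if s'%:R < c then 1 else if s%:R < c then c - s%:R else 0.

Lemma slot_time_ge0 c s s' : 0 <= slot_time c s s'.
Proof.
rewrite /slot_time; case: ifP => // _; case: ifP => // h.
by rewrite subr_ge0 ltW.
Qed.

(** Serves to exclude early completion: while the count after [n] slots is below [c], no time up to
    the end of those slots suffices. *)
Lemma data_transferred_le (r : R) (n : nat) (T : R) : 0 <= r -> 0 <= T ->
  T <= n%:R * Delta -> data_transferred Delta r Y T w <= r * Delta * (S n)%:R.
Proof.
move=> r0 T0 Tn; have rD0 : 0 <= r * Delta by rewrite mulr_ge0// ltW.
have : Num.truncn (T / Delta) == Num.truncn (T / Delta) by [].
set m := (X in _ == X); rewrite truncn_slotE// => /andP[mT Tm].
have [mn|nm] := ltnP m n; last first.
  have -> : T = n%:R * Delta.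
    apply/le_anti; rewrite Tn (le_trans _ mT)// ler_pM2r// ler_nat//.
  rewrite (@data_transferred_slot r n) ?subrr ?mulr0 ?addr0//.
  by rewrite lexx ler_pM2r// ler_nat leqnSn.
rewrite (@data_transferred_slot r m); last by rewrite mT ltW.
apply: (@le_trans _ _ (r * Delta * (S m.+1)%:R)); last first.
  by rewrite ler_wpM2l// ler_nat leq_successes.
rewrite successesS natrD [leRHS]mulrDr lerD2l mulrAC ler_wpM2r// ler_wpM2l//.
by rewrite lerBlDr (le_trans (ltW Tm))// -natr1 mulrDl mul1r addrC.
Qed.

(** If the count never reaches [c], the set of completion times is empty and every slot counts in
    full, so both sides are infinite. Otherwise the transfer ends inside the slot that first lifts
    the count to [c], and the series stops there. *)
Lemma transfer_timeE (r F : R) : 0 < r -> 0 < F ->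
  (transfer_time Delta r Y F w = \sum_(0 <= n <oo)
    (Delta * slot_time (F / (Delta * r)) (S n) (S n.+1))%:E)%E.
Proof.
move=> r0 F0; set c := F / (Delta * r).
have rD0 : 0 < r * Delta by rewrite mulr_gt0.
have c0 : 0 < c by rewrite divr_gt0// mulr_gt0.
have Fc : F = r * Delta * c by rewrite /c mulrC [Delta * r]mulrC divfK// gt_eqF.
rewrite /transfer_time /emin.
have [[n0 cn0]|Sc] := pselect (exists n, c <= (S n)%:R); last first.
  have {}Sc n : (S n)%:R < c.
    by rewrite ltNge; apply/negP => cn; apply: Sc; exists n.
  rewrite xgetPN; last first.
    move=> _ [T [[T0 FT] _] _].
    have := @data_transferred_le r (Num.truncn (T / Delta)).+1 T (ltW r0) T0.
    have : Num.truncn (T / Delta) == Num.truncn (T / Delta) by [].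
    rewrite truncn_slotE// => /andP[_ /ltW Tm] /(_ Tm).
    by apply/negP; rewrite -ltNge (lt_le_trans _ FT)// Fc ltr_pM2l.
  under eq_eseriesr do rewrite /slot_time Sc mulr1.
  apply/esym/eqyP => A A0.
  (* This many terms, each equal to [Delta], already sum to at least [A]. *)
  apply: le_trans (nneseries_lim_ge (Num.truncn (A / Delta)).+1 _);
    last by move=> i _ _; rewrite lee_fin ltW.
  rewrite sumEFin sumr_const_nat subn0 lee_fin -mulr_natl -ler_pdivrMr//.
  by rewrite ltW// truncnS_gt.
have ex : exists n, c <= (S n)%:R by exists n0.
(* Slot [n] is the one in which the transfer ends: the least index reaching [c] is positive because
   the count starts at 0 and [c > 0]. *)
case: (ex_minnP ex) => -[|n] cn minn.
  by move: cn; rewrite successes0 leNgt c0.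
have Snc : (S n)%:R < c.
  by rewrite ltNge; apply/negP => /minn; rewrite ltnn.
have yn : Y n w.
  by apply: contraTT cn => /negbTE yn; rewrite successesS yn addn0 -ltNge.
have ltc m : (m <= n)%N -> (S m)%:R < c.
  by move=> mn; rewrite (le_lt_trans _ Snc)// ler_nat leq_successes.
have cSn : c <= (S n)%:R + 1 by move: cn; rewrite successesS yn natrD.
(* All of the first [n] slots elapse, then the missing fraction of the available slot [n]. *)
pose T := Delta * (n%:R + (c - (S n)%:R)).
have Tslot : n%:R * Delta <= T <= n.+1%:R * Delta.
  rewrite /T ![_ * Delta]mulrC !ler_pM2l// -natr1 lerD2l lerDl.
  rewrite subr_ge0 (ltW Snc)/=.
  by rewrite lerBlDl.
have FT : data_transferred Delta r Y T w = F.
  by rewrite (data_transferred_slot _ Tslot) yn mulr1 [RHS]Fc /T; ring.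
have Tmin U : 0 <= U -> F <= data_transferred Delta r Y U w -> T <= U.
  move=> U0 FU; rewrite leNgt; apply/negP => UT.
  move: FU; apply/negP; rewrite -ltNge.
  (* Up to the start of slot [n] the count is too small; inside slot [n] the data increases strictly
     and equals [F] at [T]. *)
  have [Un|nU] := leP U (n%:R * Delta).
    apply: (le_lt_trans (data_transferred_le (ltW r0) U0 Un)).
    by rewrite Fc ltr_pM2l.
  rewrite -FT (data_transferred_slot _ Tslot).
  rewrite (@data_transferred_slot r n U); last first.
    by rewrite (ltW nU) (le_trans (ltW UT) (andP Tslot).2).
  by rewrite ltrD2l yn mulr1 ltr_pM2l// ltrD2r.
rewrite (@xget_unique _ _ _ T%:E)//=; last first.
- move=> _ [U [[U0 FU] Umin] <-]; congr EFin; apply/le_anti/andP; split.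
    apply: Umin => /=; split; last by rewrite FT.
    by rewrite (le_trans _ (andP Tslot).1)// mulr_ge0// ltW.
  exact: Tmin.
- exists T => //; split; first split.
  + by rewrite (le_trans _ (andP Tslot).1)// mulr_ge0// ltW.
  + by rewrite FT.
  + by move=> U [U0 FU]; exact: Tmin.
rewrite (nneseries_split 0 n.+1); last first.
  by move=> k _; rewrite lee_fin mulr_ge0 ?slot_time_ge0// ltW.
rewrite add0n eseries0 ?adde0; last first.
  move=> k nk _; rewrite /slot_time !ifF ?mulr0//.
    by apply/negbTE; rewrite -leNgt (le_trans cn)// ler_nat leq_successes.
  by apply/negbTE; rewrite -leNgt (le_trans cn)// ler_nat leq_successes// ltnW.
rewrite big_nat_recr//= /slot_time ltNge cn/= Snc.
under eq_big_nat => k kn do rewrite ltc// mulr1.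
rewrite sumEFin sumr_const_nat subn0 -EFinD.
by rewrite /T mulrDr mulr_natr.
Qed.

End path_of_one_channel.

(** * Law of the number of available slots *)

Section number_of_successes.
Context (R : realType) (d : measure_display) (Omega : measurableType d)
  (P : probability Omega R) (p : R) (Y : nat -> {RV P >-> bool}).
Hypothesis p01 : 0 < p <= 1.
Hypothesis Y_iid : iid_bernoulli P p Y.

Let p0 : 0 < p. Proof. by case/andP: p01. Qed.
Let p1 : 0 <= 1 - p. Proof. by rewrite subr_ge0; case/andP: p01. Qed.

(** The recursion splits on the outcome of the last slot; both the independence argument and the
    summation over [n] use it in this form. *)
Fixpoint binomial_pmf (n s : nat) : R :=
  match n, s with
  | 0%N, _ => (s == 0%N)%:R
  | n'.+1, 0%N => (1 - p) * binomial_pmf n' 0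
  | n'.+1, s'.+1 => (1 - p) * binomial_pmf n' s + p * binomial_pmf n' s'
  end.

Lemma binomial_pmf_ge0 n s : 0 <= binomial_pmf n s.
Proof.
elim: n s => [|n IH] [|s] //=; first by rewrite mulr_ge0.
by rewrite addr_ge0// mulr_ge0// ltW.
Qed.

Lemma prob_preimage_bernoulli (n : nat) (b : bool) :
  P (Y n @^-1` [set b]) = (if b then p else 1 - p)%:E.
Proof.
have := Y_iid.1 n [set b]; rewrite /distribution/= /pushforward => ->.
rewrite bernoulli_probE; last by case/andP: p01 => /ltW -> ->.
rewrite !diracE !in_set1; case: b; rewrite /= ?mule1 ?mule0 ?adde0 ?add0e//.
Qed.

Lemma measurable_preimage_rv (n : nat) (B : set bool) :
  measurable (Y n @^-1` B).
Proof. by rewrite -[X in measurable X]setTI; exact: measurable_funP. Qed.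

Lemma measurable_successes (n : nat) :
  measurable_fun [set: Omega] (successes Y n).
Proof.
elim: n => [|n IH].
  rewrite (_ : successes Y 0 = cst 0%N)//.
  by apply/funext => w; rewrite successes0.
rewrite (_ : successes Y n.+1 = fun w => (successes Y n w + Y n w)%N).
  apply: measurable_fun_addn => //.
  have mb : measurable_fun [set: bool] nat_of_bool by [].
  exact: (measurableT_comp mb (g := Y n)).
by apply/funext => w; rewrite successesS.
Qed.

Lemma measurable_successes_eq (n s : nat) :
  measurable [set w | successes Y n w = s].
Proof.
rewrite -[X in measurable X]setTI.
exact: (measurable_successes n _ (Y := [set s])).
Qed.

(* The extra events on later slots are what lets the induction on n consume one
   slot at a time directly from mutual independence. *)
Lemma prob_successes (n s : nat) (J : {fset nat}) (B : nat -> set bool) :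
  (forall j, j \in J -> (n <= j)%N) ->
  P ([set w | successes Y n w = s] `&`
     \bigcap_(j in [set` J]) (Y j @^-1` B j)) =
  ((binomial_pmf n s)%:E * \prod_(j <- J) P (Y j @^-1` B j))%E.
Proof.
elim: n s J B => [|n IH] s J B Jn.
  rewrite (_ : [set w | _] = if s == 0%N then setT else set0); last first.
    apply/seteqP; split => w /=; rewrite successes0; first by move=> <-.
    by case: eqP => // ->.
  rewrite /=; case: eqP => _; last by rewrite set0I measure0 mul0e.
  rewrite setTI mul1e; apply: Y_iid.2 => j _.
  by exists (B j) => //; rewrite setTI.
have nJ : n \notin J by apply/negP => /Jn; rewrite ltnn.
pose E b t := [set w | successes Y n w = t] `&`
  \bigcap_(j in [set` (n |` J)%fset])
    (Y j @^-1` (if j == n then [set b] else B j)).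
have Eb b t : (P (E b t) = ((if b then p else 1 - p) * binomial_pmf n t)%:E *
    (\prod_(j <- J) P (Y j @^-1` B j)))%E.
  rewrite IH; last first.
    by move=> j; rewrite in_fsetU in_fset1 => /orP[/eqP->//|/Jn/ltnW].
  rewrite big_fsetU1//= eqxx prob_preimage_bernoulli muleA -EFinM mulrC.
  congr (_ * _)%E; apply: eq_big_seq => j jJ.
  by rewrite ifN//; apply: contraNneq nJ => <-.
have mE b t : measurable (E b t).
  apply: measurableI; first exact: measurable_successes_eq.
  by apply: fin_bigcap_measurable => // j _; exact: measurable_preimage_rv.
have EE b t : E b t = [set w | successes Y n w = t /\ Y n w = b] `&`
   \bigcap_(j in [set` J]) (Y j @^-1` B j).
  apply/seteqP; split => [w [/= St YB]|w [/= [St Yb] YB]].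
    split.
      split => //; have := YB n; rewrite /= eqxx => -> //.
      by rewrite in_fsetU in_fset1 eqxx.
    move=> j /= jJ; have := YB j; rewrite /= ifN; last first.
      by apply: contraNneq nJ => <-.
    by apply; rewrite in_fsetU jJ orbT.
  split => // j /=; rewrite in_fsetU in_fset1 => /orP[/eqP->|jJ].
    by rewrite eqxx.
  rewrite ifN; last by apply: contraNneq nJ => <-.
  exact: YB.
have Q0 : (0 <= \prod_(j <- J) P (Y j @^-1` B j))%E by apply: prode_ge0.
case: s => [|s].
  transitivity (P (E false 0%N)); last by rewrite Eb.
  rewrite EE; congr (P _); congr (_ `&` _).
  apply/seteqP; split => w /=; rewrite successesS.
    by case: (Y n w) => /eqP; rewrite ?addn1// addn0 => /eqP.
  by move=> [-> ->].
rewrite [X in (X%:E * _)%E]/= EFinD ge0_muleDl ?lee_fin ?mulr_ge0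
  ?binomial_pmf_ge0 ?(ltW p0)//.
(* Count [s.+1] is reached in two disjoint ways: by staying there in slot [n], or by stepping up
   from [s]. *)
transitivity (P (E false s.+1) + P (E true s))%E; last by rewrite !Eb.
rewrite -measureU//; last first.
  by rewrite !EE; apply/seteqP; split => w //= [[[_ ->]]] _ [[]].
congr (P _); rewrite !EE -setIUl; congr (_ `&` _).
apply/seteqP; split => w /=; rewrite successesS.
  by case: (Y n w) => /eqP; rewrite ?addn1 ?eqSS ?addn0 => /eqP; [right|left].
by move=> [[-> ->]|[-> ->]]; rewrite ?addn0 ?addn1.
Qed.

(** * The potential of the walk at each level *)

Lemma series_binomial_pmf0 N :
  series (binomial_pmf ^~ 0%N) N.+1 =
  1 + (1 - p) * series (binomial_pmf ^~ 0%N) N.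
Proof. by rewrite /series/= big_nat_recl//= mulr_sumr. Qed.

Lemma series_binomial_pmfS N s :
  series (binomial_pmf ^~ s.+1) N.+1 =
  (1 - p) * series (binomial_pmf ^~ s.+1) N + p * series (binomial_pmf ^~ s) N.
Proof.
by rewrite /series/= big_nat_recl//= add0r big_split/= -!mulr_sumr.
Qed.

(** Partial sums increase with [N]; put into the recurrences, this gives [p] times the sum at most 1
    at level 0, and no increase of the bound from level [s] to [s.+1]. *)
Lemma series_binomial_pmf_le N s : series (binomial_pmf ^~ s) N <= p^-1.
Proof.
have mono t : series (binomial_pmf ^~ t) N <= series (binomial_pmf ^~ t) N.+1.
  by rewrite /series/= big_nat_recr//= lerDl binomial_pmf_ge0.
rewrite -(ler_pM2l p0) mulfV ?gt_eqF//.
elim: s => [|s IH].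
  by have := mono 0%N; rewrite series_binomial_pmf0; lra.
by have := mono s.+1; rewrite series_binomial_pmfS; lra.
Qed.

(** Bounded monotone sums converge, and the recurrences pass to the limits: [p * L 0 = 1] and
    [p * L s.+1 = p * L s], where [L s] is the limit at level [s]. *)
Lemma cvg_series_binomial_pmf s :
  series (binomial_pmf ^~ s) @ \oo --> p^-1.
Proof.
have cvgU t : cvgn (series (binomial_pmf ^~ t)).
  apply: nondecreasing_is_cvgn.
    apply: homo_leq => [//|? ? ?|N]; first exact: le_trans.
    by rewrite /series/= big_nat_recr//= lerDl binomial_pmf_ge0.
  by exists p^-1 => _ [N _ <-]; exact: series_binomial_pmf_le.
have shift t : series (binomial_pmf ^~ t) N.+1 @[N --> \oo] -->
    limn (series (binomial_pmf ^~ t)).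
  by rewrite (cvg_shiftS (series (binomial_pmf ^~ t))).
suff <- : limn (series (binomial_pmf ^~ s)) = p^-1 by exact: cvgU.
apply: (mulfI (lt0r_neq0 p0)); rewrite mulfV ?gt_eqF//.
elim: s => [|s IH].
  have H : series (binomial_pmf ^~ 0%N) N.+1 @[N --> \oo] -->
      1 + (1 - p) * limn (series (binomial_pmf ^~ 0%N)).
    under eq_fun do rewrite series_binomial_pmf0.
    by apply: cvgD; [exact: cvg_cst|apply: cvgMr; exact: cvgU].
  have e : limn (series (binomial_pmf ^~ 0%N)) =
      1 + (1 - p) * limn (series (binomial_pmf ^~ 0%N)).
    exact: norm_cvg_unique (shift 0%N) H.
  by lra.
have H : series (binomial_pmf ^~ s.+1) N.+1 @[N --> \oo] -->
    (1 - p) * limn (series (binomial_pmf ^~ s.+1)) +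
    p * limn (series (binomial_pmf ^~ s)).
  under eq_fun do rewrite series_binomial_pmfS.
  by apply: cvgD; apply: cvgMr; exact: cvgU.
have e : limn (series (binomial_pmf ^~ s.+1)) =
    (1 - p) * limn (series (binomial_pmf ^~ s.+1)) +
    p * limn (series (binomial_pmf ^~ s)).
  exact: norm_cvg_unique (shift s.+1) H.
by lra.
Qed.

Lemma nneseries_binomial_pmf s :
  (\sum_(0 <= n <oo) (binomial_pmf n s)%:E = p^-1%:E)%E.
Proof.
under eq_fun do rewrite sumEFin.
apply/cvg_lim => //; apply: cvg_EFin; first exact: nearW.
exact: cvg_series_binomial_pmf.
Qed.

(** * Expectation of slot contributions and of the transfer time *)

(** The pair of current count and next outcome is discrete with a product law; vanishing from level
    [K] on keeps the sum over levels finite. *)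
Lemma integral_successes (f : nat -> bool -> R) (K n : nat) :
  (forall s b, 0 <= f s b) -> (forall s b, (K <= s)%N -> f s b = 0) ->
  (\int[P]_w (f (successes Y n w) (Y n w))%:E =
   \sum_(0 <= s < K)
     (p * f s true + (1 - p) * f s false)%:E * (binomial_pmf n s)%:E)%E.
Proof.
move=> f0 fK.
pose E s b := [set w | successes Y n w = s] `&` Y n @^-1` [set b].
have mE s b : measurable (E s b).
  apply: measurableI; first exact: measurable_successes_eq.
  exact: measurable_preimage_rv.
have PE s b : P (E s b) = (binomial_pmf n s * (if b then p else 1 - p))%:E.
  have := @prob_successes n s [fset n]%fset (fun=> [set b]).
  rewrite set_fset1 bigcap_set1 big_seq_fset1 prob_preimage_bernoulli => -> //.
  by move=> j; rewrite in_fset1 => /eqP->.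
pose g s w : \bar R := ((f s true)%:E * (\1_(E s true) w)%:E +
                        (f s false)%:E * (\1_(E s false) w)%:E)%E.
have g0 s w : (0 <= g s w)%E by rewrite adde_ge0// mule_ge0// lee_fin.
have mg s b : measurable_fun [set: Omega]
    (fun w => (f s b)%:E * (\1_(E s b) w)%:E)%E.
  by apply: measurable_funeM; apply/measurable_EFinP; exact: measurable_indic.
transitivity (\int[P]_w \sum_(0 <= s < K) g s w)%E.
  apply: eq_integral => w _.
  (* At a given outcome only the level equal to the current count contributes. *)
  have gE s : g s w = (if s == successes Y n w then (f s (Y n w))%:E else 0)%E.
    rewrite /g !indicE /E !in_setI.
    have -> : (w \in [set w | successes Y n w = s]) = (s == successes Y n w).
      by rewrite eq_sym; apply/idP/eqP; rewrite inE.
    have eY b : (w \in Y n @^-1` [set b]) = (Y n w == b).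
      by apply/idP/eqP; rewrite inE.
    rewrite !eY; case: eqP => _ /=; last by rewrite !mule0 adde0.
    by case: (Y n w); rewrite ?mule1 ?mule0 ?add0e ?adde0.
  under eq_bigr do rewrite gE.
  rewrite -big_mkcond big_nat1_eq leq0n /=.
  by case: ltnP => // /fK ->.
rewrite ge0_integral_sum//; last first.
  by move=> s; apply: emeasurable_funD; exact: mg.
apply: eq_bigr => s _; rewrite /g ge0_integralD//; last 2 first.
  by move=> w _; rewrite mule_ge0// lee_fin.
  by move=> w _; rewrite mule_ge0// lee_fin.
rewrite !ge0_integralZl_EFin//; last 2 first.
  by apply/measurable_EFinP; exact: measurable_indic.
  by apply/measurable_EFinP; exact: measurable_indic.
rewrite !integral_indic// !setIT.
transitivity ((f s true)%:E * P (E s true) + (f s false)%:E * P (E s false))%E.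
  by [].
rewrite !PE -!EFinM -EFinD; congr EFin; ring.
Qed.

Lemma expected_transfer_time (Delta r F : R) :
  0 < Delta -> 0 < r -> 0 < F ->
  let c := F / (Delta * r) in
  let k := Num.truncn c in
  let alpha := c - k%:R in
  (\int[P]_w transfer_time Delta r Y F w)%E =
  (Delta * (k%:R / p + (0 < alpha)%R%:R * ((1 - p) / p) + alpha))%:E.
Proof.
move=> D0 r0 F0 c k alpha.
have c0 : 0 < c by rewrite divr_gt0// mulr_gt0.
have /andP[kc ck] : k%:R <= c < k.+1%:R by rewrite truncn_itv// ltW.
pose f s (b : bool) := Delta * slot_time c s (s + b).
(* [K] is the ceiling of [c]: from this level on the file is complete. *)
pose K := (k + (0 < alpha)%R)%N.
have f0 s b : 0 <= f s b by rewrite mulr_ge0 ?slot_time_ge0// ltW.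
have fK s b : (K <= s)%N -> f s b = 0.
  move=> Ks; have cs : c <= s%:R.
    apply: (@le_trans _ _ K%:R); last by rewrite ler_nat.
    by rewrite /K natrD; case: ltP; rewrite /alpha/= -?natr1 in ck *; lra.
  rewrite /f /slot_time !ifF ?mulr0//; apply/negbTE; rewrite -leNgt//.
  by rewrite (le_trans cs)// ler_nat leq_addr.
under eq_integral => w _ do rewrite (transfer_timeE _ _ D0 r0 F0).
rewrite integral_nneseries//; first last.
- by move=> n w _; rewrite lee_fin mulr_ge0 ?slot_time_ge0// ltW.
- move=> n; apply/measurable_EFinP; apply: measurable_funM => //.
  have mS m : measurable_fun [set: Omega] (fun w => (successes Y m w)%:R : R).
    have mnat : measurable_fun [set: nat] (fun s => s%:R : R) by [].
    exact: (measurableT_comp mnat (measurable_successes m)).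
  rewrite /slot_time; apply: measurable_fun_ifT => //.
    exact: measurable_fun_ltr.
  apply: measurable_fun_ifT => //; first exact: measurable_fun_ltr.
  exact: measurable_funB.
under eq_eseriesr => n _.
  under eq_integral => w _.
    rewrite successesS -/(f _ _).
    over.
  rewrite (integral_successes n f0 fK).
  over.
(* Summing over slots first gives each level its potential [p^-1]. *)
rewrite nneseries_sum_nat; last first.
  move=> s n; rewrite mule_ge0// lee_fin ?binomial_pmf_ge0//.
  by rewrite addr_ge0// mulr_ge0// ltW.
under eq_bigr => s _.
  rewrite nneseriesZl; last by move=> n _; rewrite lee_fin binomial_pmf_ge0.
  rewrite nneseries_binomial_pmf -EFinM.
  over.
rewrite sumEFin; congr EFin.
(* Below level [k] a slot lasts in full whatever its outcome; if [s + 1 = c], the final fraction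
   [c - s] is itself 1. *)
have Dk : \sum_(0 <= s < k) (p * f s true + (1 - p) * f s false) / p =
    Delta * (k%:R / p).
  rewrite (eq_big_nat _ _ (F2 := fun=> Delta / p)); last first.
    move=> s /andP[_ sk]; have sk1 : (s + 1)%:R <= c.
      by apply: le_trans kc; rewrite addn1 ler_nat.
    move: (sk1); rewrite natrD => sc.
    have -> : f s true = Delta.
      rewrite /f /slot_time -[(s + true)%N]/(s + 1)%N natrD.
      case: ifP => [|/negbT]; first by rewrite mulr1.
      rewrite -leNgt => cs; have -> : c = s%:R + 1 by lra.
      by rewrite ifT; [ring|lra].
    have -> : f s false = Delta.
      by rewrite /f /slot_time addn0 ifT ?mulr1//; lra.
    by congr (_ / _); ring.
  by rewrite sumr_const_nat subn0 -mulr_natr; ring.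
rewrite /K; case: ltP => /= [a0|a0]; last first.
  have -> : alpha = 0 by apply/le_anti; rewrite a0 subr_ge0.
  by rewrite addn0 Dk; ring.
rewrite addn1 big_nat_recr//= Dk.
have -> : f k true = Delta * alpha.
  by rewrite /f /slot_time addn1 ltNge (ltW ck)/= -subr_gt0 a0.
have -> : f k false = Delta.
  by rewrite /f /slot_time addn0 -subr_gt0 a0 mulr1.
by rewrite mul1r; field; exact: lt0r_neq0.
Qed.

End number_of_successes.

Theorem mainTheorem1 (R : realType) (d : measure_display)
    (Omega : measurableType d) (P : probability Omega R)
    (N : nat) (Delta : R) (r p : 'I_N -> R)
    (Y : 'I_N -> nat -> {RV P >-> bool})
    (Delta_gt0 : 0 < Delta)
    (r_gt0 : forall j, 0 < r j)
    (p_gt0_le1 : forall j, 0 < p j <= 1)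
    (Y_iid : forall j, iid_bernoulli P (p j) (Y j))
    (Y_indep : independent_sequences P Y)
    (F : R) (F_gt0 : 0 < F) (i : 'I_N) :
  let k := Num.truncn (F / (Delta * r i)) in
  let alpha := F / (Delta * r i) - k%:R in
  (\int[P]_w transfer_time Delta (r i) (Y i) F w)%E =
  (Delta * (k%:R / p i + (0 < alpha)%R%:R * ((1 - p i) / p i) + alpha))%:E.
Proof.
exact: (expected_transfer_time (p_gt0_le1 i) (Y_iid i)).
Qed.
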